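(* Let $N,n\ge1$, $\alpha,\beta>-1$, and let $\mathcal{L}=a^N(x)\frac{d^N}{dx^N}+\dots+a^1(x)\frac{d}{dx}+a^0(x)$ on $[-1,1]$ with smooth coefficients and $a^N(x)\ne0$. Let $(\phi^J_0|\cdots|\phi^J_{n-1})=(J^{(\alpha,\beta)}_0|\cdots|J^{(\alpha,\beta)}_{n+N-1})R^J$ with $R^J$ a real $(n+N)\times n$ stencil matrix. Let $A^{MPG}$ be the coefficient matrix of Mortensen's Petrov--Galerkin method, i.e. the $n\times n$ matrix with entries $$A^{MPG}(i,j)=\Big(\tfrac{1}{h^{(N)}_{N+i}}(1-x^2)^N\,\partial^NJ^{(\alpha,\beta)}_{N+i},\ \mathcal{L}\phi^J_j\Big)_{\omega^{(\alpha,\beta)}},\qquad 0\le i,j\le n-1,$$ where $h^{(N)}_N,\dots,h^{(N)}_{n+N-1}$ are nonzero normalization factors, and let $H=\operatorname{diag}(h^{(N)}_N,\dots,h^{(N)}_{n+N-1})$. Then $$A^{MPG}=H^{-1}(D^J_N)^T\,\Omega^J_{n+N-1}\,L^J_{n+N-1}\,R^J .$$ Consequently $A^{MPG}$ coincides with the coefficient matrix $A^J$, $A^J(i,j)=(\psi^J_i,\mathcal{L}\phi^J_j)_{\omega^{(\alpha+N,\beta+N)}}$, of the Jacobi-based Petrov--Galerkin method with the same trial functions and with test functions $(\psi^J_0|\cdots|\psi^J_{n-1})=(J^{(\alpha+N,\beta+N)}_0|\cdots|J^{(\alpha+N,\beta+N)}_{n+N-1})Q^J$, when $Q^J$ is chosen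 so that $(Q^J)^T=H^{-1}(D^J_N)^T$.
   Context: $J^{(\alpha,\beta)}_j$ is the classical Jacobi polynomial of degree $j$ (standard normalization $J_j^{(\alpha,\beta)}(1)=\binom{j+\alpha}{j}$), $\omega^{(\alpha,\beta)}(x)=(1-x)^\alpha(1+x)^\beta$, $(f,g)_\omega=\int_{-1}^1fg\,\omega\,dx$, $\partial=d/dx$. Indices of rows and columns start at $0$; $(f_0|f_1|\cdots)M$ is the list of functions whose $j$th member is $\sum_if_iM_{ij}$. Infinite matrices: for $k\ge1$, $\mathcal{D}^J_k$ has nonzero entries $(\mathcal{D}^J_k)_{j,j+k}=\frac{1}{2^k}\frac{\Gamma(\alpha+\beta+2k+j+1)}{\Gamma(\alpha+\beta+k+j+1)}$, $j\ge0$, only, so that $\frac{d^k}{dx^k}(J^{(\alpha,\beta)}_0|J^{(\alpha,\beta)}_1|\cdots)=(J^{(\alpha+k,\beta+k)}_0|J^{(\alpha+k,\beta+k)}_1|\cdots)\mathcal{D}^J_k$; $\mathcal{D}^J_0=\mathcal{I}$. For $k\ge0$, column $j$ of $\mathcal{M}^J_k[h]$ contains the $J^{(\alpha+k,\beta+k)}$-expansion coefficients of $hJ^{(\alpha+k,\beta+k)}_j$. For $k\ge0$, $\mathcal{S}^J_k$ is defined by $(J^{(\alpha+k,\beta+k)}_0|J^{(\alpha+k,\beta+k)}_1|\cdots)=(J^{(\alpha+k+1,\beta+k+1)}_0|J^{(\alpha+k+1,\beta+k+1)}_1|\cdots)\mathcal{S}^J_k$ (upper triangular, nonzero only on the main diagonal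 and the first two superdiagonals). With $\mathcal{P}_{n+N-1}=(I_{n+N},0)$ the projection onto components $0,\dots,n+N-1$, $$L^J_{n+N-1}=\mathcal{P}_{n+N-1}\Big(\mathcal{M}^J_N[a^N]\mathcal{D}^J_N+\sum_{k=0}^{N-1}\mathcal{S}^J_{N-1}\cdots\mathcal{S}^J_k\,\mathcal{M}^J_k[a^k]\,\mathcal{D}^J_k\Big)\mathcal{P}_{n+N-1}^{\top},$$ $$\Omega^J_{n+N-1}=\operatorname{diag}(d^J_0,\dots,d^J_{n+N-1}),\quad d^J_j=\frac{2^{\alpha+\beta+2N+1}\,\Gamma(j+\alpha+N+1)\,\Gamma(j+\beta+N+1)}{(2j+\alpha+\beta+2N+1)\,j!\,\Gamma(j+\alpha+\beta+2N+1)}.$$ $D^J_N$ is the $(n+N)\times n$ matrix consisting of rows $0,\dots,n+N-1$ and columns $N,\dots,n+N-1$ of $\mathcal{D}^J_N$. Smooth means infinitely differentiable on $[-1,1]$. *)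

(* Defs.v *)
From mathcomp Require Import all_boot all_order all_algebra.
From mathcomp Require Import all_classical all_reals all_analysis.
Set Implicit Arguments.
Unset Strict Implicit.
Unset Printing Implicit Defensive.
Import Order.TTheory GRing.Theory Num.Theory.
Import numFieldNormedType.Exports.
Local Open Scope classical_set_scope.
Local Open Scope ring_scope.

(* Only used at s > 0, where the integral converges. *)
Definition Gamma (R : realType) (s : R) : R :=
  \int[@lebesgue_measure R]_(t in `]0, +oo[) (t `^ (s - 1) * expR (- t)).

(* x (x - 1) ... (x - m + 1) / m! for real x. *)
Definition gbinom (R : realType) (x : R) (m : nat) : R :=
  (\prod_(i < m) (x - i%:R)) / (m`!)%:R.

(* Szego, Orthogonal Polynomials, (4.21.2). Only the term m = 0 survives at
   x = 1, which gives the normalization 'C(j + alpha, j). *)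
Definition jacobi (R : realType) (alpha beta : R) (j : nat) : {poly R} :=
  \sum_(m < j.+1)
    (gbinom (j%:R + alpha) (j - m) * gbinom (j%:R + alpha + beta + m%:R) m)
      *: (2^-1 *: ('X - 1%:P)) ^+ m.

Definition jweight (R : realType) (alpha beta x : R) : R :=
  (1 - x) `^ alpha * (1 + x) `^ beta.

Definition jinner (R : realType) (alpha beta : R) (f g : R -> R) : R :=
  \int[@lebesgue_measure R]_(x in `[-1, 1]) (f x * g x * jweight alpha beta x).

(* Infinitely differentiable on the closed interval [a, b], with one-sided
   derivatives at the endpoints: g k is the k-th derivative of f on [a, b].
   The values of f outside [a, b] are irrelevant. *)
Definition smooth_on (R : realType) (a b : R) (f : R -> R) : Prop :=
  exists g : nat -> R -> R,
    (forall x, x \in `[a, b] -> g 0%N x = f x) /\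
    (forall k x, x \in `[a, b] ->
       (g k y - g k x) / (y - x) @[y --> within `[a, b] x^'] --> g k.+1 x).

Definition diffop (R : realType) (N : nat) (a : nat -> R -> R) (u : R -> R) :
    R -> R :=
  fun x => \sum_(k < N.+1) a k x * (derive1n k u) x.

(* The j-th member of (f_0 | ... | f_(m-1)) M. *)
Definition qmul (R : realType) (m p : nat) (f : nat -> {poly R})
    (M : 'M[R]_(m, p)) (j : 'I_p) : {poly R} :=
  \sum_(i < m) M i j *: f i.

(* Infinite matrices are functions nat -> nat -> R. The series defining the
   entries of a product have finitely many nonzero terms in all the products
   formed below. *)
Definition imul (R : realType) (A B : nat -> nat -> R) : nat -> nat -> R :=
  fun i j => limn (series (fun l => A i l * B l j)).

Definition iid (R : realType) : nat -> nat -> R := fun i j => (i == j)%:R.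

(* The projection P A P^T onto components 0, ..., m - 1. *)
Definition itrunc (R : realType) (m : nat) (A : nat -> nat -> R) : 'M[R]_m :=
  \matrix_(i < m, j < m) A i j.

Definition jacobi_coef (R : realType) (alpha beta : R) (f : R -> R) (i : nat) :
    R :=
  jinner alpha beta (horner (jacobi alpha beta i)) f /
  jinner alpha beta (horner (jacobi alpha beta i))
                    (horner (jacobi alpha beta i)).

(* The formula for k >= 1 is not used at k = 0, where it would involve
   Gamma (alpha + beta + 1), possibly at a nonpositive argument. *)
Definition Dmat (R : realType) (alpha beta : R) (k : nat) : nat -> nat -> R :=
  if k is 0%N then iid R else
  fun i j => if j == (i + k)%N then
      (2 ^+ k)^-1 * (Gamma (alpha + beta + (2 * k)%:R + i%:R + 1) /
                     Gamma (alpha + beta + k%:R + i%:R + 1))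
    else 0.

Definition Mmat (R : realType) (alpha beta : R) (k : nat) (h : R -> R) :
    nat -> nat -> R :=
  fun i j => jacobi_coef (alpha + k%:R) (beta + k%:R)
    (fun x => h x * (jacobi (alpha + k%:R) (beta + k%:R) j).[x]) i.

(* J_j^(alpha+k,beta+k) has degree j, so its expansion in the polynomials
   J_i^(alpha+k+1,beta+k+1) only involves i <= j. *)
Definition is_conversion (R : realType) (alpha beta : R) (k : nat)
    (S : nat -> nat -> R) : Prop :=
  (forall i j, (j < i)%N -> S i j = 0) /\
  (forall j, jacobi (alpha + k%:R) (beta + k%:R) j =
     \sum_(i < j.+1) S i j *: jacobi (alpha + k.+1%:R) (beta + k.+1%:R) i).

(* The unique matrix satisfying is_conversion when alpha, beta > -1. *)
Definition Smat (R : realType) (alpha beta : R) (k : nat) : nat -> nat -> R :=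
  get [set S : nat -> nat -> R | is_conversion alpha beta k S].

(* S_(N-1) ... S_k *)
Definition Sprod (R : realType) (alpha beta : R) (N k : nat) :
    nat -> nat -> R :=
  \big[@imul R/@iid R]_(l <- rev (index_iota k N)) Smat alpha beta l.

Definition Lmat (R : realType) (alpha beta : R) (N n : nat)
    (a : nat -> R -> R) : 'M[R]_(n + N) :=
  itrunc (n + N) (fun i j =>
    imul (Mmat alpha beta N (a N)) (Dmat alpha beta N) i j +
    \sum_(k < N) imul (imul (Sprod alpha beta N k) (Mmat alpha beta k (a k)))
                      (Dmat alpha beta k) i j).

Definition Omegamat (R : realType) (alpha beta : R) (N n : nat) :
    'M[R]_(n + N) :=
  diag_mx (\row_(j < n + N)
    (2 `^ (alpha + beta + (2 * N)%:R + 1)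
      * Gamma (j%:R + alpha + N%:R + 1) * Gamma (j%:R + beta + N%:R + 1)
     / ((2 * j)%:R + alpha + beta + (2 * N)%:R + 1)
     / (j`!)%:R / Gamma (j%:R + alpha + beta + (2 * N)%:R + 1))).

(* Rows 0, ..., n+N-1 and columns N, ..., n+N-1 of D_N. *)
Definition DNmat (R : realType) (alpha beta : R) (N n : nat) :
    'M[R]_(n + N, n) :=
  \matrix_(i < n + N, j < n) Dmat alpha beta N i (N + j)%N.

Definition Hmat (R : realType) (N n : nat) (h : nat -> R) : 'M[R]_n :=
  diag_mx (\row_(i < n) h (N + i)%N).

Definition AMPG (R : realType) (alpha beta : R) (N n : nat)
    (a : nat -> R -> R) (h : nat -> R) (RJ : 'M[R]_(n + N, n)) : 'M[R]_n :=
  \matrix_(i < n, j < n)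
    jinner alpha beta
      (fun x => 1 / h (N + i)%N * (1 - x ^+ 2) ^+ N *
                (derive1n N (horner (jacobi alpha beta (N + i)))) x)
      (diffop N a (horner (qmul (jacobi alpha beta) RJ j))).

Definition AJ (R : realType) (alpha beta : R) (N n : nat)
    (a : nat -> R -> R) (QJ RJ : 'M[R]_(n + N, n)) : 'M[R]_n :=
  \matrix_(i < n, j < n)
    jinner (alpha + N%:R) (beta + N%:R)
      (horner (qmul (jacobi (alpha + N%:R) (beta + N%:R)) QJ i))
      (diffop N a (horner (qmul (jacobi alpha beta) RJ j))).

(* Main.v *)
Require Import Defs.
From mathcomp Require Import all_boot all_order all_algebra.
From mathcomp Require Import all_classical all_reals all_analysis.
From mathcomp Require Import measurable_realfun ring lra.
Import Order.TTheory GRing.Theory Num.Theory.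
Import numFieldNormedType.Exports.
Set Implicit Arguments.
Unset Strict Implicit.
Unset Printing Implicit Defensive.
Local Open Scope classical_set_scope.
Local Open Scope ring_scope.

(**
  Since d^N J_(N+i) is a multiple of J_i^(alpha+N,beta+N) and
  (1-x^2)^N w^(alpha,beta) = w^(alpha+N,beta+N), every entry of A^MPG is a
  multiple of the inner product of J_i^(alpha+N,beta+N) with L phi_j for the
  weight w^(alpha+N,beta+N).  On the other side, S_k turns the coefficients of
  an arbitrary function in the basis J^(alpha+k,beta+k) into its coefficients
  for k+1: by orthogonality S_k is, up to the norms, the transpose of
  multiplication by 1-x^2 from one basis to the other, so each of its rows is
  finite and no convergence of Jacobi expansions is involved.  Hence column j of
  L^J holds the exact J^(alpha+N,beta+N)-coefficients of L J_j, and
  multiplication by Omega^J turns them into inner products.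

  That Omega^J contains the squared norms rests on the Euler Beta integral
  Gamma a Gamma b = Gamma (a+b) B(a,b), obtained from Tonelli's theorem.  It
  gives the moments of the weight in powers of 1+x, their recurrence is
  integration by parts against polynomials, and with the Jacobi differential
  equation this yields
  j (J_j, p)_w^(a,b) = (1/2) (J_(j-1)^(a+1,b+1), p')_w^(a+1,b+1),
  from which orthogonality and norms follow by induction on j.
*)

(** * Gamma and Beta integrals *)

Section AffineChange.
Context {R : realType}.
Notation mu := (@lebesgue_measure R).

Lemma preimage_affine_itv (u c x y : R) : 0 < u ->
  (fun t : R => u * t + c) @^-1` `]x, y] = `](x - c) / u, (y - c) / u]%classic.
Proof.
move=> u0; apply/seteqP; split => t /=;
  by rewrite !in_itv/= ltr_pdivrMr// ler_pdivlMr// ltrBlDr lerBrDr (mulrC t).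
Qed.

Lemma measurable_affine (u c : R) :
  measurable_fun [set: R] (fun t : R => u * t + c).
Proof. by apply: measurable_funD => //; exact: mulrl_measurable. Qed.

(** The image of Lebesgue measure under the affine map, rescaled by [u], gives each half-open
    interval its length. By uniqueness it is Lebesgue measure, and integrating against an image
    measure is composing with the map. *)
Lemma ge0_integral_affine (u c : R) (f : R -> \bar R) : 0 < u ->
  measurable_fun [set: R] f -> (forall x, 0 <= f x)%E ->
  (\int[mu]_x f x = u%:E * \int[mu]_x f (u * x + c)%R)%E.
Proof.
move=> u0 mf f0.
pose phi : measurableTypeR R -> measurableTypeR R :=
  fun t : R => u * t + c.
have mphi : measurable_fun [set: measurableTypeR R] phi.
  exact: measurable_affine.
(* nu' takes as argument the measurability proof that turns the pushforward into
   a measure. *)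
pose nu : set (measurableTypeR R) -> \bar R := pushforward mu phi.
pose nu' : {measure set (measurableTypeR R) -> \bar R} :=
  mscale (NngNum (ltW u0)) nu.
have -> : (\int[mu]_x f x = \int[nu' mphi]_x f x)%E.
  apply: (@eq_measure_integral _ (measurableTypeR R) R setT (nu' mphi) mu).
  move=> /= A mA _.
  apply/lebesgue_measure_unique => //= _ [[a b]] _ <-.
  rewrite /mscale/= /pushforward preimage_affine_itv//.
  rewrite !lebesgue_measure_itv/= !lte_fin ltr_pM2r ?invr_gt0// ltrD2r.
  case: ifPn => _; last by rewrite mule0.
  by rewrite -!EFinB -EFinM; congr EFin; field; rewrite gt_eqF.
by rewrite ge0_integral_mscale//= ge0_integral_pushforward.
Qed.

End AffineChange.

Section EulerIntegrals.
Context {R : realType}.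
Notation mu := (@lebesgue_measure R).

(* powR is 1 at negative arguments; tpow extends the power by 0 instead, so that
   all integrals below can be taken over the whole line. *)
Definition tpow (s t : R) : R := if 0 < t then t `^ s else 0.

Lemma tpow_ge0 (s t : R) : 0 <= tpow s t.
Proof. by rewrite /tpow; case: ifP => // _; exact: powR_ge0. Qed.

Lemma measurable_tpow (s : R) : measurable_fun [set: R] (tpow s).
Proof.
by apply: measurable_fun_ifT => //; exact: measurable_fun_ltr.
Qed.

Lemma tpowM (s u t : R) : 0 < u -> tpow s (u * t) = u `^ s * tpow s t.
Proof.
move=> u0; rewrite /tpow pmulr_rgt0//; case: ifPn => t0; last by rewrite mulr0.
by rewrite powRM// ltW.
Qed.

Lemma tpowS (s t : R) : tpow (s + 1) t = t * tpow s t.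
Proof.
rewrite /tpow; case: ifPn => t0; last by rewrite mulr0.
by rewrite powRD ?(gt_eqF t0) ?implybT// powRr1 ?(ltW t0)// mulrC.
Qed.

(** Extended-real values allow Tonelli's theorem to be applied before finiteness is known;
    finiteness is then deduced from the resulting identities. *)
Definition eGamma (s : R) : \bar R :=
  (\int[mu]_t (tpow (s - 1) t * expR (- t))%:E)%E.

Definition eBeta (a b : R) : \bar R :=
  (\int[mu]_t (tpow (a - 1) t * tpow (b - 1) (1 - t))%:E)%E.

Lemma Gamma_eGamma (s : R) : Gamma s = fine (eGamma s).
Proof.
rewrite /Gamma /Rintegral /eGamma integral_mkcond; congr fine.
apply: eq_integral => t _; rewrite restrict_EFin; congr EFin.
rewrite patchE /tpow mem_setE in_itv/= andbT.
by case: ifPn => // _; rewrite mul0r.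
Qed.

Lemma measurable_Gamma_integrand (s : R) :
  measurable_fun [set: R] (fun t => (tpow (s - 1) t * expR (- t))%:E).
Proof.
apply/measurable_EFinP; apply: measurable_funM; first exact: measurable_tpow.
by apply: measurableT_comp => //; exact: measurable_expR.
Qed.

Lemma measurable_Beta_integrand (a b : R) :
  measurable_fun [set: R]
    (fun t => (tpow (a - 1) t * tpow (b - 1) (1 - t))%:E).
Proof.
apply/measurable_EFinP; apply: measurable_funM; first exact: measurable_tpow.
by apply: measurableT_comp; [exact: measurable_tpow|exact: measurable_funB].
Qed.

Lemma eGamma_ge0 s : (0 <= eGamma s)%E.
Proof.
by apply: integral_ge0 => t _; rewrite lee_fin mulr_ge0 ?tpow_ge0 ?expR_ge0.
Qed.

(** The product is a double integral over [t] and [s]. Putting [u = t + s], exchanging the order and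
    rescaling [t] by [u] separates it. All integrands are nonnegative, so infinite values are
    allowed. *)
Lemma eGammaM (a b : R) :
  (eGamma a * eGamma b = eGamma (a + b) * eBeta a b)%E.
Proof.
pose F (z : R * R) : \bar R :=
  (tpow (a - 1) z.1 * (tpow (b - 1) (z.2 - z.1) * expR (- z.2)))%:E.
have F0 z : (0 <= F z)%E by rewrite lee_fin !mulr_ge0 ?tpow_ge0 ?expR_ge0.
have mF : measurable_fun setT F.
  apply/measurable_EFinP; apply: measurable_funM.
    by apply: measurableT_comp => //; exact: measurable_tpow.
  apply: measurable_funM.
    apply: measurableT_comp; first exact: measurable_tpow.
    by apply: measurable_funB.
  by do 2 apply: measurableT_comp => //.
transitivity (\int[mu]_t \int[mu]_u F (t, u))%E.
  rewrite /eGamma -ge0_integralZr//=; first last.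
  - exact: eGamma_ge0.
  - by move=> t _; rewrite lee_fin mulr_ge0 ?tpow_ge0 ?expR_ge0.
  - exact: measurable_Gamma_integrand.
  apply: eq_integral => t _.
  transitivity (\int[mu]_s ((tpow (a - 1) t * expR (- t))%:E *
                            (tpow (b - 1) s * expR (- s))%:E))%E.
    rewrite ge0_integralZl//.
    - exact: measurable_Gamma_integrand.
    - by move=> s _; rewrite lee_fin mulr_ge0 ?tpow_ge0 ?expR_ge0.
    - by rewrite lee_fin mulr_ge0 ?tpow_ge0 ?expR_ge0.
  (* Substitution [s = u - t] at fixed [t]. *)
  rewrite (@ge0_integral_affine _ 1 (- t))//; first last.
  - by move=> u; rewrite -EFinM lee_fin !mulr_ge0 ?tpow_ge0 ?expR_ge0.
  - by apply: measurable_funeM; exact: measurable_Gamma_integrand.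
  rewrite mul1e; apply: eq_integral => u _; rewrite /F/= -EFinM; congr EFin.
  rewrite mul1r -!mulrA; congr (_ * _); rewrite mulrCA; congr (_ * _).
  by rewrite -expRD; congr expR; ring.
rewrite fubini_tonelli//.
rewrite [eGamma (a + b)]/eGamma -ge0_integralZr//=; first last.
- by apply: integral_ge0 => t _; rewrite lee_fin mulr_ge0 ?tpow_ge0.
- by move=> t _; rewrite lee_fin mulr_ge0 ?tpow_ge0 ?expR_ge0.
- exact: measurable_Gamma_integrand.
apply: eq_integral => u _.
(* [F (t, u)] is supported on [0 < t < u], so both sides vanish for [u <= 0]. *)
have [u0|u0] := ltP 0 u; last first.
  rewrite [in RHS]/tpow ltNge u0/= mul0r mul0e.
  rewrite integral0_eq// => t _; rewrite /F/= /tpow.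
  case: ifPn => t0; last by rewrite mul0r.
  by rewrite subr_gt0 ltNge (le_trans u0 (ltW t0))/= mul0r mulr0.
rewrite (@ge0_integral_affine _ u 0)//; last first.
  exact: (measurable_fun_pair1 u mF).
transitivity (u%:E * \int[mu]_t
    ((u `^ (a - 1) * (u `^ (b - 1) * expR (- u)))%:E *
     (tpow (a - 1) t * tpow (b - 1) (1 - t))%:E))%E.
  congr (_ * _)%E; apply: eq_integral => t _; rewrite /F/= addr0 -EFinM.
  congr EFin.
  by rewrite (_ : u - u * t = u * (1 - t)); [rewrite !tpowM//; ring | ring].
rewrite ge0_integralZl//; first last.
- by rewrite lee_fin !mulr_ge0 ?powR_ge0 ?expR_ge0.
- by move=> t _; rewrite lee_fin mulr_ge0 ?tpow_ge0.
- exact: measurable_Beta_integrand.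
rewrite muleA -EFinM; congr (_%:E * _)%E.
(* The extra power of [u] is the Jacobian of the rescaling. *)
rewrite (_ : a + b - 1 = a - 1 + (b - 1) + 1); last by ring.
rewrite tpowS /tpow u0 (powRD (r := a - 1)).
  by ring.
by rewrite (gt_eqF u0) implybT.
Qed.

Lemma integral_powR_itvc1 (s c : R) : 0 < s -> 0 < c < 1 ->
  (\int[mu]_(t in `[c, 1%R]) (t `^ (s - 1))%:E = (s^-1 - c `^ s / s)%:E)%E.
Proof.
move=> s0 /andP[c0 c1].
have pos (x : R) : c <= x -> 0 < x by exact: lt_le_trans.
have dF (x : R) : 0 < x ->
    is_derive x 1 (fun t : R => s^-1 * t `^ s) (x `^ (s - 1)).
  move=> x0; rewrite -[X in is_derive _ _ _ X](mulKf (lt0r_neq0 s0)).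
  exact: (is_deriveZ s^-1 (is_derive1_powR s x0)).
rewrite (@continuous_FTC2 _ _ (fun t => s^-1 * t `^ s))//.
- by rewrite powR1 mulr1 EFinB mulrC.
- apply: derivable_within_continuous => x; rewrite in_itv/= => /andP[cx _].
  by apply: derivable_powR; rewrite in_itv/= andbT pos.
- have cF (x : R) : c <= x -> {for x, continuous (fun t : R => s^-1 * t `^ s)}.
    move=> /pos /dF ?.
    by apply/differentiable_continuous/derivable1_diffP/ex_derive.
  split.
  + move=> x; rewrite in_itv/= => /andP[/ltW/pos/dF ? _]; exact: ex_derive.
  + by apply: cvg_at_right_filter; exact: cF.
  + by apply: cvg_at_left_filter; apply: cF; exact: ltW.
- move=> x; rewrite in_itv/= => /andP[/ltW/pos/dF ? _].
  by rewrite derive1E derive_val.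
Qed.

(** The integrand may be unbounded at 0, so the fundamental theorem of calculus is used on [[c, 1]]
    and monotone convergence lets [c] tend to 0. *)
Lemma eBeta_1r (s : R) : 0 < s -> eBeta s 1 = (s^-1)%:E.
Proof.
move=> s0.
have mp (D : set R) : measurable_fun D (fun t => (t `^ (s - 1))%:E).
  by apply/measurable_EFinP; apply: measurable_funTS; exact: measurable_powR.
have -> : eBeta s 1 = (\int[mu]_(t in `]0%R, 1%R]) (t `^ (s - 1))%:E)%E.
  rewrite -integral_itv_bndo_bndc; last exact: mp.
  rewrite integral_mkcond; apply: eq_integral => t _.
  rewrite restrict_EFin; congr EFin.
  rewrite patchE mem_setE in_itv/= /tpow subrr powRr0 subr_gt0.
  by case: (0 < t); case: (t < 1); rewrite /= ?mulr1 ?mulr0 ?mul0r.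
(* Starting at 1/2 rather than 1 keeps the left endpoint strictly below 1, as [integral_powR_itvc1]
   requires. *)
pose F (n : nat) : set R := `[n.+2%:R^-1, 1]%classic.
have -> : `]0%R, 1%R]%classic = \bigcup_n F n.
  apply/seteqP; split => [x|x [n _]]; rewrite /F/= in_itv/=.
    move=> /andP[x0 x1]; have [n] := ltr_add_invr x0.
    rewrite add0r => nx; exists n => //=.
    rewrite in_itv/= x1 andbT (le_trans _ (ltW nx))//.
    by rewrite lef_pV2 ?posrE// ler_nat.
  by rewrite in_itv/= => /andP[nx ->]; rewrite andbT (lt_le_trans _ nx).
have cvg1 : (\int[mu]_(t in F n) (t `^ (s - 1))%:E)%E @[n --> \oo] -->
            (\int[mu]_(t in \bigcup_n F n) (t `^ (s - 1))%:E)%E.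
  apply: ge0_nondecreasing_set_cvg_integral => //.
  - move=> m n mn; apply/subsetPset => x.
    rewrite /F/= !in_itv/= => /andP[mx ->].
    by rewrite andbT (le_trans _ mx)// lef_pV2 ?posrE// ler_nat !ltnS.
  - move=> n; exact: measurable_itv.
  - move=> n; apply/measurable_EFinP; apply: measurable_funTS.
    exact: measurable_powR.
  - by move=> n x _; rewrite lee_fin powR_ge0.
have cvg2 : (\int[mu]_(t in F n) (t `^ (s - 1))%:E)%E @[n --> \oo] -->
            (s^-1)%:E.
  rewrite [X in X @ _ --> _](_ : _ =
      fun n => (s^-1 - n.+2%:R^-1 `^ s / s)%:E); last first.
    apply/funext => n; rewrite integral_powR_itvc1//.
    by rewrite invr_gt0 ltr0n/= invf_lt1// ltr1n.
  apply: cvg_EFin; first exact: nearW.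
  rewrite -[X in _ --> X]subr0 -[X in _ --> _ - X](mul0r s^-1).
  apply: cvgB; first exact: cvg_cst.
  apply: cvgMr_tmp.
  have /cvg_at_rightP := powR_cvg0 s0; apply; split => [n|].
    by rewrite invr_gt0.
  by have := @cvg_harmonic R; rewrite -cvg_shiftS.
exact: cvg_unique cvg1 cvg2.
Qed.

Lemma eGamma1 : eGamma 1 = 1%E.
Proof.
rewrite -(@integral_exponential_pdf R 1)//.
have -> : eGamma 1 = (\int[mu]_(t in `]0%R, +oo[) (expR (- t))%:E)%E.
  rewrite integral_mkcond; apply: eq_integral => t _.
  rewrite restrict_EFin; congr EFin.
  rewrite patchE mem_setE in_itv/= andbT /tpow subrr powRr0.
  by case: ifPn; rewrite ?mul1r ?mul0r.
rewrite integral_itv_obnd_cbnd; last first.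
  by apply/measurable_EFinP; apply: measurable_funTS; exact: measurableT_comp.
rewrite integral_mkcond; apply: eq_integral => t _.
rewrite restrict_EFin; congr EFin.
by rewrite /exponential_pdf !patchE; case: ifPn => // _; rewrite mul1r mulN1r.
Qed.

(** The functional equation of Gamma is the case [b = 1] of [eGammaM]. *)
Lemma eGamma_pred (s : R) : 0 < s -> eGamma s = (eGamma (s + 1) * (s^-1)%:E)%E.
Proof. by move=> s0; rewrite -eBeta_1r// -eGammaM eGamma1 mule1. Qed.

(** The functional equation gives finiteness at positive integers and reduces [s] to [s + 1], where
    the power [t ^ s] is bounded by [1 + t ^ n] for any integer [n >= s]. *)
Lemma eGamma_fin (s : R) : 0 < s -> eGamma s \is a fin_num.
Proof.
move=> s0.
have eGammaS (x : R) : 0 < x -> eGamma (x + 1) = (x%:E * eGamma x)%E.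
  move=> x0; rewrite [eGamma x]eGamma_pred// muleCA -EFinM divff ?mule1//.
  by rewrite gt_eqF.
have eGamma_nat n : eGamma n.+1%:R \is a fin_num.
  elim: n => [|n ih]; first by rewrite eGamma1.
  by rewrite -natr1 eGammaS// fin_numM.
rewrite eGamma_pred// fin_numM//.
have [n sn] : exists n : nat, s <= n%:R.
  by exists (Num.bound s); exact/ltW/archi_boundP/ltW.
rewrite ge0_fin_numE ?eGamma_ge0//.
apply: (@le_lt_trans _ _ (eGamma 1 + eGamma n.+1%:R)%E); last first.
  rewrite ltey_eq; apply/orP; left.
  by rewrite fin_numD; apply/andP; split; [rewrite eGamma1|exact: eGamma_nat].
rewrite /eGamma -ge0_integralD//=; first last.
- exact: measurable_Gamma_integrand.
- by move=> t _; rewrite lee_fin mulr_ge0 ?tpow_ge0 ?expR_ge0.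
- exact: measurable_Gamma_integrand.
- by move=> t _; rewrite lee_fin mulr_ge0 ?tpow_ge0 ?expR_ge0.
apply: ge0_le_integral => //=.
- by move=> t _; rewrite lee_fin mulr_ge0 ?tpow_ge0 ?expR_ge0.
- exact: measurable_Gamma_integrand.
- by apply: emeasurable_funD; exact: measurable_Gamma_integrand.
move=> t _; rewrite -EFinD lee_fin -mulrDl ler_wpM2r ?expR_ge0//.
rewrite /tpow; case: ifPn => t0; last by rewrite addr0.
rewrite addrK subrr powRr0 -natr1 addrK.
have [t1|t1] := leP 1 t.
  by rewrite (le_trans (ler_powR t1 sn))// lerDr.
by rewrite ler_wpDr ?powR_ge0// -(powRr0 t) ger_powR// ?t0 ltW.
Qed.

Lemma GammaS (s : R) : 0 < s -> Gamma (s + 1) = s * Gamma s.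
Proof.
move=> s0; rewrite !Gamma_eGamma [eGamma s]eGamma_pred// fineM//.
  by rewrite mulrCA divff ?mulr1// gt_eqF.
by rewrite eGamma_fin// addr_gt0.
Qed.

(** After passing to [s + 1], the integrand is at least [expR (- 2)] on [[1, 2]]. *)
Lemma Gamma_gt0 (s : R) : 0 < s -> 0 < Gamma s.
Proof.
move=> s0; suff : 0 < Gamma (s + 1) by rewrite GammaS// pmulr_rgt0.
have fG : eGamma (s + 1) \is a fin_num by rewrite eGamma_fin// addr_gt0.
rewrite Gamma_eGamma -lte_fin fineK//.
apply: (@lt_le_trans _ _ (\int[mu]_(t in `[1%R, 2%R]) (expR (- 2))%:E)%E).
  rewrite integral_cst//= lebesgue_measure_itv/= lte_fin ltr1n/=.
  by rewrite -EFinB -EFinM lte_fin mulr_gt0 ?expR_gt0// subr_gt0 ltr1n.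
rewrite /eGamma.
apply: (@le_trans _ _ (\int[mu]_(t in `[1%R, 2%R])
    (tpow (s + 1 - 1) t * expR (- t))%:E)%E).
  apply: ge0_le_integral => //=.
  - by apply: measurable_funTS; exact: measurable_Gamma_integrand.
  move=> t; rewrite in_itv/= => /andP[t1 t2]; rewrite lee_fin addrK.
  rewrite /tpow (lt_le_trans _ t1)// -[leLHS]mul1r ler_pM ?expR_ge0//.
    by rewrite -(powRr0 t) ler_powR// ltW.
  by rewrite ler_expR lerN2.
apply: ge0_subset_integral => //=.
- exact: measurable_Gamma_integrand.
- by move=> t _; rewrite lee_fin mulr_ge0 ?tpow_ge0 ?expR_ge0.
Qed.

(** In [eGammaM] the left side is finite and [Gamma (a + b)] is positive, which rules out an
    infinite Beta integral and permits the division. *)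
Lemma eBetaE (a b : R) : 0 < a -> 0 < b ->
  eBeta a b = (Gamma a * Gamma b / Gamma (a + b))%:E.
Proof.
move=> a0 b0; have ab0 : 0 < a + b by exact: addr_gt0.
have := eGammaM a b.
move: (eGamma_fin a0) (eGamma_fin b0) (eGamma_fin ab0) (Gamma_gt0 ab0).
rewrite !Gamma_eGamma; move: eGamma (eBeta a b) => G B fa fb fab G0.
rewrite -(fineK fa) -(fineK fb) -(fineK fab) -EFinM /=.
case: B => [r| |].
- by rewrite -EFinM => -[->]; congr EFin; field; rewrite gt_eqF.
- by rewrite gt0_muley ?lte_fin.
- by rewrite gt0_muleNy ?lte_fin.
Qed.

End EulerIntegrals.

(** * Jacobi polynomials *)

Section JacobiAlgebra.
Context {R : realType}.
Implicit Types (a b x : R) (j m k : nat).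

Lemma gbinom0 x : gbinom x 0 = 1.
Proof. by rewrite /gbinom big_ord0 fact0 divr1. Qed.

Lemma gbinomS x k : k.+1%:R * gbinom x k.+1 = gbinom x k * (x - k%:R).
Proof.
have k0 : k`!%:R != 0 :> R by rewrite pnatr_eq0 -lt0n fact_gt0.
rewrite /gbinom big_ord_recr/= factS natrM; field.
by rewrite k0 nat1r pnatr_eq0.
Qed.

Lemma gbinomSS x k : k.+1%:R * gbinom (x + 1) k.+1 = (x + 1) * gbinom x k.
Proof.
have k0 : k`!%:R != 0 :> R by rewrite pnatr_eq0 -lt0n fact_gt0.
rewrite /gbinom big_ord_recl/= factS natrM subr0.
under eq_bigr => i _ do rewrite /bump /= add1n -natr1 opprD addrACA addrN addr0.
by field; rewrite k0 nat1r pnatr_eq0.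
Qed.

(** Coefficients of the Jacobi polynomial in powers of [(x - 1) / 2]. *)
Definition jcoef a b j m : R :=
  if (m <= j)%N then
    gbinom (j%:R + a) (j - m) * gbinom (j%:R + a + b + m%:R) m
  else 0.

(** The hypergeometric recurrence, which is the Jacobi differential equation read on coefficients.
    At [m = j] the factor [j - m] makes it terminate. *)
Lemma jcoef_rec a b j m :
  m.+1%:R * (m%:R + a + 1) * jcoef a b j m.+1 =
  (j%:R - m%:R) * (j%:R + m%:R + a + b + 1) * jcoef a b j m.
Proof.
rewrite /jcoef; have [mj|jm|->] := ltngtP m j; last 2 first.
- by rewrite !mulr0.
- by rewrite subrr !mul0r mulr0.
have [k jk] : exists k, j = (m + k.+1)%N.
  by exists (j - m).-1; rewrite prednK ?subn_gt0// subnKC// ltnW.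
have -> : (j - m.+1 = k)%N by rewrite jk addnS subSS addKn.
have -> : (j - m = k.+1)%N by rewrite jk addKn.
have H1 := gbinomS (j%:R + a) k.
have H2 := gbinomSS (j%:R + a + b + m%:R) m.
rewrite (_ : j%:R + a + b + m.+1%:R = j%:R + a + b + m%:R + 1); last first.
  by rewrite -[m.+1%:R]natr1; ring.
rewrite (_ : j%:R - m%:R = k.+1%:R); last by rewrite jk natrD; ring.
rewrite (_ : j%:R + a - k%:R = m%:R + a + 1) in H1; last first.
  by rewrite jk natrD -[k.+1%:R]natr1; ring.
transitivity (gbinom (j%:R + a) k * (m%:R + a + 1) *
   (m.+1%:R * gbinom (j%:R + a + b + m%:R + 1) m.+1)); first by ring.
by rewrite -H1 H2; ring.
Qed.

Lemma jcoef_deriv a b j m :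
  m.+1%:R * jcoef a b j.+1 m.+1 =
  (j%:R + a + b + 2) * jcoef (a + 1) (b + 1) j m.
Proof.
rewrite /jcoef ltnS; case: ifPn => mj; last by rewrite !mulr0.
rewrite subSS mulrCA gbinomS.
have -> : j.+1%:R + a = j%:R + (a + 1) by rewrite -[j.+1%:R]natr1; ring.
have -> : j%:R + (a + 1) + b + m.+1%:R = j%:R + (a + 1) + (b + 1) + m%:R.
  by rewrite -[m.+1%:R]natr1; ring.
by ring.
Qed.

Definition jpoly a b j : {poly R} := \poly_(m < j.+1) jcoef a b j m.

Lemma coef_jpoly a b j m : (jpoly a b j)`_m = jcoef a b j m.
Proof. by rewrite coef_poly ltnS /jcoef; case: (m <= j)%N. Qed.

Lemma jacobi_comp a b j :
  jacobi a b j = jpoly a b j \Po (2^-1 *: ('X - 1%:P)).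
Proof.
rewrite /jacobi /jpoly poly_def raddf_sum/=; apply: eq_bigr => m _.
by rewrite comp_polyZ comp_Xn_poly /jcoef -ltnS ltn_ord.
Qed.

Lemma jpoly_deriv a b j :
  (jpoly a b j.+1)^`() = (j%:R + a + b + 2) *: jpoly (a + 1) (b + 1) j.
Proof.
apply/polyP => m; rewrite coef_deriv coefZ !coef_jpoly -jcoef_deriv.
by rewrite mulr_natl.
Qed.

Lemma jpoly_ode a b j : let P := jpoly a b j in
  ('X + 'X^2) * P^`()^`() + ((a + 1)%:P + (a + b + 2) *: 'X) * P^`() =
  (j%:R * (j%:R + a + b + 1)) *: P.
Proof.
move=> P; apply/polyP => m.
rewrite !mulrDl -!scalerAl expr2 -mulrA !coefD !coefZ !coefCM !coefXM.
rewrite !coef_deriv !coef_jpoly.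
(* Multiplication by ['X] and ['X^2] shifts coefficients by up to two places, so indices 0 and 1 are
   separate. *)
case: m => [|[|m]] /=.
- have := jcoef_rec a b j 0; lra.
- have := jcoef_rec a b j 1; lra.
- have := jcoef_rec a b j m.+2; lra.
Qed.

Lemma jacobi_deriv a b j :
  (jacobi a b j.+1)^`() =
  ((j%:R + a + b + 2) / 2) *: jacobi (a + 1) (b + 1) j.
Proof.
rewrite !jacobi_comp deriv_comp jpoly_deriv derivZ derivB derivX derivC subr0.
by rewrite comp_polyZ -scalerAl -scalerAr mulr1 scalerA.
Qed.

(** Substituting [x = 2 q + 1] in [jpoly_ode] gives it, since [1 - x^2 = - 4 (q + q^2)] and each
    derivative in [x] contributes a factor 1/2. *)
Lemma jacobi_ode a b j : let J := jacobi a b j in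
  (1 - 'X^2) * J^`()^`() + ((b - a)%:P - (a + b + 2) *: 'X) * J^`() =
  - (j%:R * (j%:R + a + b + 1)) *: J.
Proof.
move=> J; rewrite /J jacobi_comp; set q := _ *: _.
have dq : q^`() = (2^-1)%:P.
  by rewrite derivZ derivB derivX derivC subr0 alg_polyC.
have /(congr1 (fun P => P \Po q)) := jpoly_ode a b j.
rewrite /= !rmorphD/= !rmorphM/= !rmorphD/= !comp_polyZ comp_polyX comp_polyC.
rewrite comp_Xn_poly => H.
rewrite scaleNr -H !deriv_comp derivM dq derivC mulr0 addr0 deriv_comp dq.
rewrite -!mul_polyC.
have -> : 'X = 2%:P * q + 1 :> {poly R}.
  by rewrite /q -mul_polyC mulrA -polyCM divff// mul1r subrK.
have h : 2%:P * (2^-1)%:P = 1 :> {poly R} by rewrite -polyCM divff.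
rewrite !(polyCD, polyCB, polyCN).
move: h; set u := (2^-1)%:P; set c2 := 2%:P => h.
have c2E : c2 = 1 + 1 by rewrite /c2 -polyCD.
set A := _ \Po q; set B := _ \Po q.
(* The products [c2 * u], equal to 1 by [h], are collected first because [ring] treats [u] as a free
   variable. *)
transitivity (- ((q + q ^+ 2) * A * (c2 * u) ^+ 2
    + (a%:P + 1%:P + (a%:P + b%:P + c2) * q) * B * (c2 * u))).
  by rewrite c2E polyC1; ring.
by rewrite h; ring.
Qed.

(** The leading coefficient is, up to a nonzero constant, the product of the [2 j + a + b - i] over
    [i < j], all positive because [a + b > -2]. *)
Lemma size_jacobi a b j : -1 < a -> -1 < b -> size (jacobi a b j) = j.+1.
Proof.
move=> a1 b1; rewrite jacobi_comp size_comp_poly2; last first.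
  by rewrite size_scale ?invr_eq0 ?pnatr_eq0// size_XsubC.
rewrite size_poly_eq//= /jcoef leqnn subnn gbinom0 mul1r /gbinom.
rewrite mulf_neq0 ?invr_eq0 ?pnatr_eq0 -?lt0n ?fact_gt0//.
apply/prodf_neq0 => i _; rewrite gt_eqF//.
have : i.+1%:R <= j%:R :> R by rewrite ler_nat.
have : 1 <= j%:R :> R by rewrite ler1n (leq_ltn_trans _ (ltn_ord i)).
rewrite -[i.+1%:R]natr1; lra.
Qed.

Lemma poly_basis_expansion (J : nat -> {poly R}) n (p : {poly R}) :
  (forall i, size (J i) = i.+1) -> (size p <= n)%N ->
  exists c : nat -> R, p = \sum_(i < n) c i *: J i.
Proof.
move=> sJ; elim: n p => [|n ih] p sp.
  exists (fun=> 0); rewrite big_ord0; apply/eqP; rewrite -size_poly_leq0.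
  exact: sp.
have Jn0 : (J n)`_n != 0.
  by have := lead_coef_eq0 (J n); rewrite lead_coefE sJ -size_poly_eq0 sJ => ->.
pose d := p`_n / (J n)`_n.
have [|c pE] := ih (p - d *: J n).
  apply/leq_sizeP => i; rewrite leq_eqVlt => /predU1P[<-|ni].
    by rewrite coefB coefZ divfK// subrr.
  rewrite coefB coefZ !nth_default ?mulr0 ?subr0// ?sJ//.
  exact: leq_trans sp ni.
exists (fun i => if (i == n)%N then d else c i).
rewrite big_ord_recr/= eqxx -[LHS](subrK (d *: J n)) pE; congr (_ + _).
by apply: eq_bigr => i _; rewrite ltn_eqF.
Qed.

End JacobiAlgebra.

(** * Integration against the Jacobi weight *)

Section WithinContinuous.
Context {R : realType} (A : set R).
Implicit Types f g : R -> R.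

Lemma within_continuous_cst (c : R) : {within A, continuous (fun=> c)}.
Proof. by move=> x; exact: cst_continuous. Qed.

Lemma within_continuousD f g : {within A, continuous f} ->
  {within A, continuous g} -> {within A, continuous (fun x => f x + g x)}.
Proof. by move=> cf cg x; apply: cvgD; [exact: cf|exact: cg]. Qed.

Lemma within_continuousM f g : {within A, continuous f} ->
  {within A, continuous g} -> {within A, continuous (fun x => f x * g x)}.
Proof. by move=> cf cg x; apply: cvgM; [exact: cf|exact: cg]. Qed.

Lemma within_continuous_horner (p : {poly R}) :
  {within A, continuous (horner p)}.
Proof. by apply: continuous_subspaceT; exact: continuous_horner. Qed.

Lemma within_continuous_sum n (f : 'I_n -> R -> R) :
  (forall i, {within A, continuous (f i)}) ->
  {within A, continuous (fun x => \sum_i f i x)}.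
Proof.
elim: n f => [|n ih] f cf.
  under eq_fun do rewrite big_ord0; exact: within_continuous_cst.
under eq_fun do rewrite big_ord_recl.
by apply: within_continuousD => //; apply: ih => i; exact: cf.
Qed.

End WithinContinuous.

Section JacobiWeight.
Context {R : realType}.
Notation mu := (@lebesgue_measure R).
Implicit Types (a b : R) (f g : R -> R).

Lemma measurable_jweight a b : measurable_fun [set: R] (jweight a b).
Proof.
by apply: measurable_funM;
  apply: (measurableT_comp (measurable_powR _)) => //;
  [exact: measurable_funB|exact: measurable_funD].
Qed.

(** At [x = 0] both sides vanish because [a + 1] is nonzero; this makes the shift of the weight
    exact at the endpoints. *)
Lemma mulr_powR a (x : R) : -1 < a -> 0 <= x -> x * x `^ a = x `^ (a + 1).
Proof.
move=> a1 x0; have a10 : 0 < a + 1 by rewrite -ltrBlDr sub0r.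
by rewrite -(mulr_powRB1 x0 a10) addrK.
Qed.

(** The substitution [x = 2 t - 1] turns the integral into a Beta integral. *)
Lemma integral_jweight a b : -1 < a -> -1 < b ->
  (\int[mu]_(x in `[(-1)%R, 1%R]) (jweight a b x)%:E =
   (2 `^ (a + b + 1) * Gamma (a + 1) * Gamma (b + 1) / Gamma (a + b + 2))%:E)%E.
Proof.
move=> a1 b1.
have a10 : 0 < a + 1 by rewrite -ltrBlDr sub0r.
have b10 : 0 < b + 1 by rewrite -ltrBlDr sub0r.
rewrite integral_itv_bndoo; last first.
  by apply/measurable_EFinP; apply: measurable_funTS; exact: measurable_jweight.
transitivity (\int[mu]_x (tpow a (1 - x) * tpow b (1 + x))%:E)%E.
  rewrite integral_mkcond; apply: eq_integral => x _.
  rewrite restrict_EFin; congr EFin.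
  rewrite patchE mem_setE in_itv/= -subr_gt0 opprK addrC.
  rewrite -[x < 1]subr_gt0 /tpow /jweight.
  by case: (0 < 1 + x); case: (0 < 1 - x); rewrite /= ?mulr0 ?mul0r.
rewrite (@ge0_integral_affine _ 2 (-1))//; first last.
- by move=> x; rewrite lee_fin mulr_ge0 ?tpow_ge0.
- apply/measurable_EFinP; apply: measurable_funM;
    (apply: measurableT_comp; first exact: measurable_tpow).
  + exact: measurable_funB.
  + exact: measurable_funD.
transitivity (2%:E * (\int[mu]_x ((2 `^ (a + b))%:E *
    (tpow (b + 1 - 1) x * tpow (a + 1 - 1) (1 - x))%:E)))%E.
  congr (_ * _)%E; apply: eq_integral => x _; rewrite -EFinM; congr EFin.
  rewrite (_ : 1 - (2 * x - 1) = 2 * (1 - x)); last by ring.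
  rewrite (_ : 1 + (2 * x - 1) = 2 * x); last by ring.
  rewrite !tpowM// !addrK powRD; last by rewrite pnatr_eq0 implybT.
  by ring.
rewrite ge0_integralZl//; first last.
- by move=> x _; rewrite lee_fin mulr_ge0 ?tpow_ge0.
- exact: measurable_Beta_integrand.
rewrite -/(eBeta _ _) eBetaE// -!EFinM; congr EFin.
rewrite [2 `^ (a + b + 1)]powRD; last by rewrite pnatr_eq0 implybT.
rewrite powRr1// (_ : b + 1 + (a + 1) = a + b + 2); last by ring.
by move: (Gamma _) (Gamma _) (Gamma _) => G1 G2 G3; ring.
Qed.

Lemma integrable_jweight a b : -1 < a -> -1 < b ->
  mu.-integrable `[-1, 1] (EFin \o jweight a b).
Proof.
move=> a1 b1; apply/integrableP; split.
  by apply/measurable_EFinP; apply: measurable_funTS; exact: measurable_jweight.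
under eq_integral => x _ do rewrite /= ger0_norm ?mulr_ge0 ?powR_ge0//.
by rewrite integral_jweight// ltry.
Qed.

(** A convergent difference quotient times [y - x] tends to 0. *)
Lemma smooth_on_continuous (u v : R) f : smooth_on u v f ->
  {within `[u, v], continuous f}.
Proof.
move=> [g [g0 gS]].
suff key (x : R) : x \in `[u, v] ->
    f y @[y --> within `[u, v] (nbhs x)] --> f x.
  by apply/subspace_continuousP => x xuv; exact: key.
move=> xI; have FF : Filter (within `[u, v] x^') by exact: within_filter.
have FF' : Filter (within `[u, v] (nbhs x)) by exact: within_filter.
have L := gS 0%N x xI.
have D : (y - x) @[y --> within `[u, v] x^'] --> (0 : R).
  apply: cvg_within_filter; apply: cvg_within_filter.
  have : (id \- cst x) y @[y --> x] --> x - x.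
    by apply: cvgB; [exact: cvg_id|exact: cvg_cst].
  by rewrite subrr.
have P : (g 0%N y - g 0%N x) / (y - x) * (y - x)
    @[y --> within `[u, v] x^'] --> (0 : R).
  by have := cvgM L D; rewrite mulr0; apply.
apply/cvgrPdist_lt => e e0.
move/cvgrPdist_lt: P => /(_ e e0); rewrite !near_withinE => P.
apply: filterS P => y /= yP yuv.
(* The quotient is controlled only on the punctured neighbourhood, so [y = x] is checked
   directly. *)
have [->|yx] := eqVneq y x; first by rewrite subrr normr0.
by have := yP yx yuv; rewrite divfK ?subr_eq0// sub0r opprB !g0.
Qed.

(** Convertible with [jinner] when [f] is a pointwise product, so that inner products become
    integrals of one function. *)
Definition jint a b f : R := \int[mu]_(x in `[-1, 1]) (f x * jweight a b x).

Lemma integrable_jint a b f : -1 < a -> -1 < b ->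
  {within `[-1, 1], continuous f} ->
  mu.-integrable `[-1, 1] (EFin \o (fun x => f x * jweight a b x)).
Proof.
move=> a1 b1 cf.
apply: (@integrableMr _ _ _ mu `[-1, 1] _ f (EFin \o jweight a b)).
- exact: measurable_itv.
- by apply: subspace_continuous_measurable_fun => //; exact: measurable_itv.
- have /compact_bounded := continuous_compact cf (@segment_compact _ (-1) 1).
  by move=> [M [Mr Mf]]; exists M; split => // N /Mf fN x xI;
    apply: fN; exists x.
- exact: integrable_jweight.
Qed.

Lemma eq_jint a b f g : (forall x, -1 <= x <= 1 -> f x = g x) ->
  jint a b f = jint a b g.
Proof.
move=> fg; apply: eq_Rintegral => x; rewrite inE/= in_itv/= => xI.
by rewrite fg.
Qed.

Lemma jintD a b f g : -1 < a -> -1 < b ->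
  {within `[-1, 1], continuous f} -> {within `[-1, 1], continuous g} ->
  jint a b (fun x => f x + g x) = jint a b f + jint a b g.
Proof.
move=> a1 b1 cf cg; rewrite /jint -RintegralD//; try exact: integrable_jint.
by apply: eq_Rintegral => x _; rewrite mulrDl.
Qed.

Lemma jintZ a b (c : R) f : -1 < a -> -1 < b ->
  {within `[-1, 1], continuous f} ->
  jint a b (fun x => c * f x) = c * jint a b f.
Proof.
move=> a1 b1 cf; rewrite /jint -RintegralZl//; last exact: integrable_jint.
by apply: eq_Rintegral => x _; rewrite mulrA.
Qed.

Lemma jint_sum a b n (f : 'I_n -> R -> R) : -1 < a -> -1 < b ->
  (forall i, {within `[-1, 1], continuous (f i)}) ->
  jint a b (fun x => \sum_i f i x) = \sum_i jint a b (f i).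
Proof.
move=> a1 b1 cf; elim: n f cf => [|n ih] f cf.
  rewrite big_ord0 -[RHS](mul0r (jint a b (fun=> 0))) -jintZ//.
    by apply: eq_jint => x _; rewrite big_ord0 mul0r.
  exact: within_continuous_cst.
rewrite big_ord_recl -ih// -jintD//.
  by apply: eq_jint => x _; rewrite big_ord_recl.
by apply: within_continuous_sum => i; exact: cf.
Qed.

Lemma jint_shift a b f : -1 < a -> -1 < b ->
  jint (a + 1) (b + 1) f = jint a b (fun x => (1 - x ^+ 2) * f x).
Proof.
move=> a1 b1; apply: eq_Rintegral => x; rewrite inE/= in_itv/= => /andP[x1 x2].
rewrite /jweight -!mulr_powR ?subr_ge0//; first by ring.
by rewrite addrC -lerBlDr sub0r.
Qed.

(** The power of [1 + x] is absorbed into the weight, replacing [b] by [b + m]. *)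
Lemma jint_pow a b m : -1 < a -> -1 < b ->
  jint a b (fun x => (1 + x) ^+ m) =
  2 `^ (a + (b + m%:R) + 1) * Gamma (a + 1) * Gamma (b + m%:R + 1)
    / Gamma (a + (b + m%:R) + 2).
Proof.
move=> a1 b1; have bm1 : -1 < b + m%:R by rewrite (lt_le_trans b1)// lerDl.
have /(congr1 fine) /= <- := integral_jweight a1 bm1.
apply: eq_Rintegral => x; rewrite inE/= in_itv/= => /andP[x1 x2].
have x0 : 0 <= 1 + x by rewrite addrC -lerBlDr sub0r.
rewrite /jweight mulrCA; congr (_ * _).
elim: m {bm1} => [|m ih]; first by rewrite addr0 expr0 mul1r.
rewrite exprS -mulrA ih mulr_powR//; first by rewrite -addrA natr1.
by rewrite (lt_le_trans b1)// lerDl.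
Qed.

Lemma jint_pow_recr a b m : -1 < a -> -1 < b ->
  (a + b + m%:R + 2) * jint a b (fun x => (1 + x) ^+ m.+1) =
  2 * (b + m%:R + 1) * jint a b (fun x => (1 + x) ^+ m).
Proof.
move=> a1 b1.
have m0 : 0 <= m%:R :> R by [].
have b10 : 0 < b + m%:R + 1 by lra.
have ab0 : 0 < a + (b + m%:R) + 2 by lra.
rewrite (jint_pow m a1 b1) (jint_pow m.+1 a1 b1) -[m.+1%:R]natr1.
rewrite (_ : a + (b + (m%:R + 1)) + 1 = a + (b + m%:R) + 1 + 1); last by ring.
rewrite (_ : a + (b + (m%:R + 1)) + 2 = a + (b + m%:R) + 2 + 1); last by ring.
rewrite (_ : b + (m%:R + 1) + 1 = b + m%:R + 1 + 1); last by ring.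
rewrite [2 `^ (_ + 1 + 1)]powRD; last by rewrite pnatr_eq0 implybT.
rewrite (GammaS b10) (GammaS ab0) powRr1//.
have := Gamma_gt0 ab0.
move: (Gamma _) (Gamma _) (Gamma _) => G1 G2 G3 G0.
by field; rewrite !gt_eqF.
Qed.

End JacobiWeight.

(** * Orthogonality *)

Section JacobiOrthogonality.
Context {R : realType}.
Implicit Types (a b : R) (p q r : {poly R}) (j : nat).

Definition pint a b p : R := jint a b (horner p).

Lemma pintD a b p q : -1 < a -> -1 < b ->
  pint a b (p + q) = pint a b p + pint a b q.
Proof.
move=> a1 b1; rewrite /pint -jintD//; try exact: within_continuous_horner.
by apply: eq_jint => x _; rewrite hornerD.
Qed.

Lemma pintZ a b c p : -1 < a -> -1 < b -> pint a b (c *: p) = c * pint a b p.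
Proof.
move=> a1 b1; rewrite /pint -jintZ//; last exact: within_continuous_horner.
by apply: eq_jint => x _; rewrite hornerZ.
Qed.

Lemma pint_sum a b n (q : 'I_n -> {poly R}) : -1 < a -> -1 < b ->
  pint a b (\sum_i q i) = \sum_i pint a b (q i).
Proof.
move=> a1 b1; rewrite /pint -jint_sum//; last first.
  by move=> i; exact: within_continuous_horner.
by apply: eq_jint => x _; rewrite horner_sum.
Qed.

Lemma pint_shift a b p : -1 < a -> -1 < b ->
  pint (a + 1) (b + 1) p = pint a b ((1 - 'X^2) * p).
Proof.
move=> a1 b1; rewrite /pint jint_shift//.
by apply: eq_jint => x _; rewrite !hornerE.
Qed.

(** With [w] the Jacobi weight, this is the derivative of [w (1 - x^2) r] divided by [w]. *)
Definition pearson a b r : {poly R} :=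
  (1 - 'X^2) * r^`() + ((b - a)%:P - (a + b + 2) *: 'X) * r.

(** Only two powers occur because [1 - x^2 = (1 + x) (2 - (1 + x))]. *)
Lemma pearson_pow a b m :
  pearson a b (('X + 1) ^+ m) =
  (2 * (b + m%:R + 1)) *: ('X + 1) ^+ m -
  (a + b + m%:R + 2) *: ('X + 1) ^+ m.+1.
Proof.
rewrite /pearson deriv_exp derivD derivX derivC addr0.
rewrite -!mul_polyC !(polyCD, polyCM, polyCB, polyC_natr) polyC1 mul1r.
case: m => [|m]; first by rewrite /= mulr0n !expr0; ring.
by rewrite /= -mulr_natl !exprS -[m.+1%:R]natr1; ring.
Qed.

Lemma pearson_sum a b n (c : nat -> R) (q : nat -> {poly R}) :
  pearson a b (\sum_(i < n) c i *: q i) =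
  \sum_(i < n) c i *: pearson a b (q i).
Proof.
rewrite /pearson raddf_sum/= !mulr_sumr -big_split; apply: eq_bigr => i _ /=.
by rewrite derivZ -!scalerAr scalerDr.
Qed.

(* The integrand is the derivative of (1-x)^(a+1) (1+x)^(b+1) r(x), which
   vanishes at both endpoints; on the basis (1+x)^m the claim is the recurrence
   of the moments. *)
Lemma pint_pearson a b r : -1 < a -> -1 < b -> pint a b (pearson a b r) = 0.
Proof.
move=> a1 b1.
(* Taylor expansion of [r] at [-1]. *)
have -> : r = \sum_(i < size (r \Po ('X - 1)))
    (r \Po ('X - 1))`_i *: ('X + 1) ^+ i.
  by rewrite -comp_polyE -polyC1 -[LHS](comp_polyXaddC_K _ (- 1)) polyCN opprK.
rewrite (pearson_sum _ _ _ _ (fun i => ('X + 1) ^+ i)) pint_sum//.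
apply: big1 => i _; rewrite pintZ// pearson_pow -scaleNr pintD// !pintZ//.
have pX m : pint a b (('X + 1) ^+ m) = jint a b (fun x => (1 + x) ^+ m).
  by apply: eq_jint => x _; rewrite !hornerE addrC.
by rewrite !pX mulNr jint_pow_recr// subrr mulr0.
Qed.

(** [pint_pearson] is applied to the product of the derivative of [jacobi a b j.+1] with [p]. The
    differential equation turns its second-order part into a multiple of [jacobi a b j.+1 * p]. The
    factor [l] occurs both in the eigenvalue and in [jacobi_deriv], and cancels. *)
Lemma pint_jacobiS a b j p : -1 < a -> -1 < b ->
  j.+1%:R * pint a b (jacobi a b j.+1 * p) =
  2^-1 * pint (a + 1) (b + 1) (jacobi (a + 1) (b + 1) j * p^`()).
Proof.
move=> a1 b1; pose l := j%:R + a + b + 2.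
have j0 : 0 <= j%:R :> R by [].
have l0 : l != 0 by rewrite gt_eqF// /l; lra.
have a11 : -1 < a + 1 by lra.
have b11 : -1 < b + 1 by lra.
apply: (mulfI l0); rewrite mulrA [RHS]mulrA.
rewrite -(pintZ _ _ a1 b1) -(pintZ _ _ a11 b11).
have := pint_pearson ((jacobi a b j.+1)^`() * p) a1 b1.
have -> : pearson a b ((jacobi a b j.+1)^`() * p) =
    - 1 *: ((l * j.+1%:R) *: (jacobi a b j.+1 * p)) +
    (1 - 'X^2) * ((jacobi a b j.+1)^`() * p^`()).
  have /= := jacobi_ode a b j.+1.
  rewrite (_ : j.+1%:R * _ = l * j.+1%:R); last first.
    by rewrite /l -[j.+1%:R]natr1; ring.
  have -> : -1 *: ((l * j.+1%:R) *: (jacobi a b j.+1 * p)) =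
      (- (l * j.+1%:R) *: jacobi a b j.+1) * p.
    by rewrite scaleN1r -scaleNr scalerAl.
  move=> <-.
  by rewrite /pearson derivM; ring.
rewrite (pintD _ _ a1 b1) (pintZ (-1) _ a1 b1) -(pint_shift _ a1 b1).
rewrite jacobi_deriv -scalerAl mulN1r.
by move/eqP; rewrite addrC subr_eq0 => /eqP <-.
Qed.

(** Each use of [pint_jacobiS] lowers [j] and differentiates [p] while raising the parameters, hence
    the induction over all [a] and [b]; it ends at [p = 0]. *)
Lemma pint_jacobi_lt a b j p : -1 < a -> -1 < b -> (size p <= j)%N ->
  pint a b (jacobi a b j * p) = 0.
Proof.
elim: j a b p => [|j ih] a b p a1 b1 sp.
  move: sp; rewrite size_poly_leq0 => /eqP ->.
  by rewrite mulr0 -(scale0r (0 : {poly R})) pintZ// mul0r.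
have j0 : j.+1%:R != 0 :> R by rewrite pnatr_eq0.
apply: (mulfI j0); rewrite pint_jacobiS// ih ?mulr0//; try lra.
have [->|p0] := eqVneq p 0; first by rewrite derivC size_poly0.
by rewrite -ltnS (leq_trans _ sp)// lt_size_deriv.
Qed.

Definition jnorm a b j : R := pint a b (jacobi a b j * jacobi a b j).

Lemma jnormS a b j : -1 < a -> -1 < b ->
  jnorm a b j.+1 = (j%:R + a + b + 2) / (4 * j.+1%:R) * jnorm (a + 1) (b + 1) j.
Proof.
move=> a1 b1; have j0 : j.+1%:R != 0 :> R by rewrite pnatr_eq0.
apply: (mulfI j0); rewrite pint_jacobiS// jacobi_deriv -scalerAr pintZ; try lra.
by rewrite -/(jnorm _ _ _); field; rewrite nat1r.
Qed.

Lemma jnorm0 a b : -1 < a -> -1 < b ->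
  jnorm a b 0 =
  2 `^ (a + b + 1) * Gamma (a + 1) * Gamma (b + 1) / Gamma (a + b + 2).
Proof.
move=> a1 b1; have := jint_pow 0 a1 b1; rewrite addr0 => <-.
apply: eq_jint => x _; rewrite /jacobi big_ord1 /= subnn !gbinom0 !expr0.
by rewrite mulr1 scale1r mulr1 hornerE.
Qed.

Lemma jnorm_gt0 a b j : -1 < a -> -1 < b -> 0 < jnorm a b j.
Proof.
elim: j a b => [|j ih] a b a1 b1.
  rewrite jnorm0// divr_gt0 ?mulr_gt0 ?powR_gt0 ?Gamma_gt0//; lra.
have j0 : 0 <= j%:R :> R by [].
have ab : 0 < j%:R + a + b + 2 by lra.
rewrite jnormS//; apply: mulr_gt0; last by apply: ih; lra.
by apply: divr_gt0 => //; apply: mulr_gt0.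
Qed.

(* Gamma and jnorm are abstracted because conversion would otherwise unfold the
   integrals that define them. *)
Lemma jnorm_closed_form (G : R -> R) (nu : R -> R -> nat -> R) :
  (forall s, 0 < s -> G (s + 1) = s * G s) ->
  (forall s, 0 < s -> 0 < G s) ->
  (forall a b, -1 < a -> -1 < b ->
     nu a b 0%N = 2 `^ (a + b + 1) * G (a + 1) * G (b + 1) / G (a + b + 2)) ->
  (forall a b j, -1 < a -> -1 < b ->
     nu a b j.+1 = (j%:R + a + b + 2) / (4 * j.+1%:R) * nu (a + 1) (b + 1) j) ->
  forall j a b, -1 < a -> -1 < b -> 0 < a + b + 1 ->
  nu a b j = 2 `^ (a + b + 1) * G (j%:R + a + 1) * G (j%:R + b + 1)
    / ((2 * j)%:R + a + b + 1) / (j`!)%:R / G (j%:R + a + b + 1).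
Proof.
move=> GS G0 nu0 nuS; elim=> [|j ih] a b a1 b1 ab.
  rewrite nu0// fact0 muln0 mulr0n !add0r.
  rewrite (_ : a + b + 2 = a + b + 1 + 1); last by ring.
  have Gab := G0 _ ab; rewrite (GS _ ab); field.
  by rewrite !gt_eqF.
have j0 : 0 <= j%:R :> R by [].
have ab' : 0 < j%:R + a + b + 2 by lra.
rewrite nuS// ih; try lra.
rewrite (_ : a + 1 + (b + 1) + 1 = a + b + 1 + 1 + 1); last by ring.
rewrite (_ : j%:R + (a + 1) + (b + 1) + 1 = j%:R + a + b + 2 + 1); last by ring.
rewrite (_ : j%:R + (a + 1) + 1 = j%:R + a + 2); last by ring.
rewrite (_ : j%:R + (b + 1) + 1 = j%:R + b + 2); last by ring.
rewrite mulnS natrD factS natrM -![j.+1%:R]natr1.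
rewrite (_ : j%:R + 1 + a + b + 1 = j%:R + a + b + 2); last by ring.
rewrite (_ : j%:R + 1 + a + 1 = j%:R + a + 2); last by ring.
rewrite (_ : j%:R + 1 + b + 1 = j%:R + b + 2); last by ring.
rewrite (GS _ ab') [2 `^ (_ + 1 + 1)]powRD; last by rewrite pnatr_eq0 implybT.
rewrite [2 `^ (a + b + 1 + 1)]powRD; last by rewrite pnatr_eq0 implybT.
rewrite powRr1// natrM.
have := G0 _ ab'; have := fact_gt0 j; rewrite -(ltr0n R).
move: (j`!%:R) (_ `^ _) => f t f0 Gab.
field.
by rewrite !gt_eqF//; lra.
Qed.

(** The condition on [a + b] keeps every Gamma argument positive, also at [j = 0]. It holds for
    parameters raised by [N >= 1]. *)
Lemma jnormE a b j : -1 < a -> -1 < b -> 0 < a + b + 1 ->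
  jnorm a b j = 2 `^ (a + b + 1) * Gamma (j%:R + a + 1) * Gamma (j%:R + b + 1)
    / ((2 * j)%:R + a + b + 1) / (j`!)%:R / Gamma (j%:R + a + b + 1).
Proof.
exact: (jnorm_closed_form (@GammaS R) (@Gamma_gt0 R) jnorm0 jnormS).
Qed.

End JacobiOrthogonality.

(** * The coefficient matrices *)

Section InfiniteMatrices.
Context {R : realType}.
Implicit Types A B : nat -> nat -> R.

Lemma imul_finite A B i j m : (forall l, (m <= l)%N -> A i l * B l j = 0) ->
  imul A B i j = \sum_(l < m) A i l * B l j.
Proof.
move=> AB0; apply/cvg_lim => //; apply: cvg_near_cst; near=> n.
have mn : (m <= n)%N by near: n; exact: nbhs_infty_ge.
rewrite /series/= -(subnKC mn) (big_cat_nat _ (leq_addr _ _))//=.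
rewrite big_mkord [X in _ + X](_ : _ = 0) ?addr0//.
by rewrite big_nat big1// => l /andP[ml _]; exact: AB0.
Unshelve. all: by end_near. Qed.

End InfiniteMatrices.

Section JacobiMatrices.
Context {R : realType} (alpha beta : R).
Hypotheses (alpha_gt : -1 < alpha) (beta_gt : -1 < beta).
Notation al k := (alpha + k%:R).
Notation be k := (beta + k%:R).
Notation J k := (jacobi (al k) (be k)).
Implicit Types (i j k l m N : nat) (f g h : R -> R) (A : nat -> nat -> R).

Lemma al_gt k : -1 < al k.
Proof. by rewrite (lt_le_trans alpha_gt)// lerDl. Qed.

Lemma be_gt k : -1 < be k.
Proof. by rewrite (lt_le_trans beta_gt)// lerDl. Qed.

Lemma alS k : al k.+1 = al k + 1. Proof. by rewrite -natr1 addrA. Qed.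
Lemma beS k : be k.+1 = be k + 1. Proof. by rewrite -natr1 addrA. Qed.

(** * Differentiation matrices *)

Lemma derive1n_horner k (p : {poly R}) :
  derive1n k (horner p) = horner p^`(k).
Proof.
elim: k => [|k ih]; first by rewrite derivn0.
by rewrite derive1nS ih derivnS derivE.
Qed.

(** One more derivative multiplies the entry by the factor of [jacobi_deriv] at the raised
    parameters. *)
Lemma Dmat_rec k i :
  Dmat alpha beta k.+1 i (i + k.+1) =
  Dmat alpha beta k i.+1 (i.+1 + k) * ((i%:R + al k + be k + 2) / 2).
Proof.
have a1 := alpha_gt; have b1 := beta_gt.
have i0 : 0 <= i%:R :> R by [].
have k0 : 0 <= k%:R :> R by [].
have := @Gamma_gt0 R; have := @GammaS R; rewrite /Dmat; case: k k0 => [|k] k0.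
  (* For [k = 0] the matrix is the identity and not a Gamma quotient, so this case is computed
     apart. *)
  rewrite /iid !addn0 !eqxx mul1r expr1 muln1 => GS G0.
  rewrite (_ : _ + 2 + _ + 1 = alpha + beta + i%:R + 2 + 1); last by ring.
  rewrite (_ : _ + 1 + _ + 1 = alpha + beta + i%:R + 2); last by ring.
  have s0 : 0 < alpha + beta + i%:R + 2 by lra.
  have Gs := G0 _ s0.
  by rewrite (GS _ s0); field; rewrite gt_eqF.
rewrite addSnnS !eqxx => GS G0.
rewrite [X in Gamma X / _](_ : _ =
  alpha + beta + (2 * k.+1)%:R + i.+1%:R + 1 + 1); last first.
  by rewrite mulnS natrD -[i.+1%:R]natr1; ring.
rewrite [X in _ * (_ / Gamma X) = _](_ : _ =
  alpha + beta + k.+1%:R + i.+1%:R + 1); last first.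
  by rewrite -[k.+2%:R]natr1 -[i.+1%:R]natr1; ring.
rewrite GS; last by rewrite natrM -[i.+1%:R]natr1; lra.
have := G0 (alpha + beta + k.+1%:R + i.+1%:R + 1).
rewrite exprS natrM -[i.+1%:R]natr1 => G1.
have {G1} G1 : Gamma (alpha + beta + k.+1%:R + (i%:R + 1) + 1) != 0.
  by rewrite gt_eqF// G1//; lra.
move: G1; move: (Gamma _) (Gamma _) => G2 G3 G30.
by field; rewrite G30 expf_neq0// pnatr_eq0.
Qed.

Lemma derivn_jacobi k i :
  (jacobi alpha beta (i + k))^`(k) = Dmat alpha beta k i (i + k) *: J k i.
Proof.
elim: k i => [|k ih] i.
  by rewrite derivn0 !addn0 !addr0 /= /iid eqxx scale1r.
rewrite derivnS -addSnnS ih derivZ jacobi_deriv -alS -beS scalerA.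
by rewrite addSnnS Dmat_rec addSnnS.
Qed.

Lemma Dmat_eq0 k i j : j != (i + k)%N -> Dmat alpha beta k i j = 0.
Proof.
case: k => [|k] /negbTE; last by rewrite /Dmat => ->.
by rewrite addn0 /Dmat /iid eq_sym => ->.
Qed.

(** * Conversion matrices between consecutive bases *)

Lemma pint_jacobi_neq k i j : i != j -> pint (al k) (be k) (J k i * J k j) = 0.
Proof.
have [a1 b1] := (al_gt k, be_gt k).
rewrite neq_ltn => /orP[ij|ji]; last by rewrite pint_jacobi_lt ?size_jacobi.
by rewrite mulrC pint_jacobi_lt ?size_jacobi.
Qed.

(** [Smat] is chosen by [get], so its property follows once some conversion matrix exists; expanding
    each polynomial in the next basis supplies one. *)
Lemma is_conversion_Smat k : is_conversion alpha beta k (Smat alpha beta k).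
Proof.
have [a1 b1] := (al_gt k, be_gt k).
have [a2 b2] := (al_gt k.+1, be_gt k.+1).
rewrite /Smat; set E := [set S | _].
suff : E !=set0 by move=> [S ES]; have := @getPex _ E (ex_intro _ S ES).
have H j : exists c : nat -> R, J k j = \sum_(i < j.+1) c i *: J k.+1 i.
  apply: poly_basis_expansion; last by rewrite size_jacobi.
  by move=> i; rewrite size_jacobi.
have [c cE] := choice H.
exists (fun i j => if (i <= j)%N then c j i else 0); split=> [i j ji|j].
  by rewrite leqNgt ji.
by rewrite cE; apply: eq_bigr => i _; rewrite -ltnS ltn_ord.
Qed.

Lemma Smat_pint k i j :
  Smat alpha beta k i j * jnorm (al k.+1) (be k.+1) i =
  pint (al k.+1) (be k.+1) (J k.+1 i * J k j).
Proof.
have [a1 b1] := (al_gt k, be_gt k).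
have [a2 b2] := (al_gt k.+1, be_gt k.+1).
have [S0 SE] := is_conversion_Smat k.
have [ij|ji] := leqP i j; last first.
  by rewrite S0// mul0r pint_jacobi_lt// size_jacobi.
rewrite [in RHS]SE mulr_sumr (pint_sum _ a2 b2).
rewrite (bigD1 (Ordinal (ij : (i < j.+1)%N)))//= big1 ?addr0.
  by rewrite -scalerAr (pintZ _ _ a2 b2).
move=> l li; rewrite -scalerAr (pintZ _ _ a2 b2) pint_jacobi_neq ?mulr0//.
by rewrite eq_sym; apply: contraNneq li => li; apply/eqP/val_inj.
Qed.

Lemma Smat_pint_low k i j :
  Smat alpha beta k i j * jnorm (al k.+1) (be k.+1) i =
  pint (al k) (be k) (J k j * ((1 - 'X^2) * J k.+1 i)).
Proof.
rewrite Smat_pint alS beS (pint_shift _ (al_gt k) (be_gt k)); congr pint.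
by ring.
Qed.

Lemma size_shift_jacobi k i : (size ((1 - 'X^2) * J k.+1 i)%R <= i.+3)%N.
Proof.
apply: leq_trans (size_polyMleq _ _) _.
rewrite size_jacobi ?al_gt ?be_gt// addnS/= -[i.+3]add3n leq_add2r.
rewrite (leq_trans (size_polyD _ _))// size_polyN size_polyXn size_poly1.
by [].
Qed.

(** By [Smat_pint_low] the entry is an inner product of [J k j] with a polynomial of degree at most
    [i + 2]. *)
Lemma Smat_band k i j : (i.+3 <= j)%N -> Smat alpha beta k i j = 0.
Proof.
move=> ij; have N0 := jnorm_gt0 i (al_gt k.+1) (be_gt k.+1).
apply: (mulIf (lt0r_neq0 N0)); rewrite mul0r Smat_pint_low.
apply: pint_jacobi_lt; [exact: al_gt|exact: be_gt|].
exact: leq_trans (size_shift_jacobi k i) ij.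
Qed.

Notation cont f := {within `[(-1 : R), 1], continuous (f : R -> R)}.

Lemma jacobi_coefE k f i :
  jacobi_coef (al k) (be k) f i =
  jint (al k) (be k) (fun x => (J k i).[x] * f x) / jnorm (al k) (be k) i.
Proof.
rewrite /jacobi_coef; congr (_ / _).
by apply: eq_jint => x _; rewrite hornerM.
Qed.

Lemma jacobi_coefS k f i : cont f ->
  jacobi_coef (al k.+1) (be k.+1) f i =
  \sum_(l < i.+3) Smat alpha beta k i l * jacobi_coef (al k) (be k) f l.
Proof.
move=> cf; have [a1 b1] := (al_gt k, be_gt k).
have N0 := jnorm_gt0 i (al_gt k.+1) (be_gt k.+1).
(* The finite expansion of [(1 - 'X^2) * J k.+1 i] in the lower basis has row [i] of [Smat],
   rescaled by norms, as its coefficients; it is then integrated against [f]. *)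
have [t tE] := poly_basis_expansion (fun l => size_jacobi l a1 b1)
  (size_shift_jacobi k i).
have tS l : (l < i.+3)%N ->
    t l * jnorm (al k) (be k) l =
    Smat alpha beta k i l * jnorm (al k.+1) (be k.+1) i.
  move=> li; rewrite Smat_pint_low tE mulr_sumr (pint_sum _ a1 b1).
  rewrite (bigD1 (Ordinal li))//= big1 ?addr0.
    by rewrite -scalerAr (pintZ _ _ a1 b1).
  move=> p pl; rewrite -scalerAr (pintZ _ _ a1 b1) pint_jacobi_neq ?mulr0//.
  by rewrite eq_sym; apply: contraNneq pl => pl; apply/eqP/val_inj.
rewrite jacobi_coefE; apply: (mulIf (lt0r_neq0 N0)).
rewrite divfK ?(lt0r_neq0 N0)// mulr_suml [in LHS]alS [in LHS]beS.
rewrite (jint_shift _ a1 b1).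
transitivity (jint (al k) (be k)
    (fun x => \sum_(l < i.+3) t l * ((J k l).[x] * f x))).
  apply: eq_jint => x _; rewrite mulrA.
  have -> : (1 - x ^+ 2) * (jacobi (al k + 1) (be k + 1) i).[x] =
      ((1 - 'X^2) * J k.+1 i).[x] by rewrite alS beS !hornerE.
  rewrite tE horner_sum mulr_suml; apply: eq_bigr => l _.
  by rewrite hornerZ mulrA.
have cJ l : cont (fun x => (J k l).[x] * f x).
  by apply: within_continuousM => //; exact: within_continuous_horner.
rewrite (jint_sum a1 b1); last first.
  by move=> l; apply: within_continuousM => //; exact: within_continuous_cst.
apply: eq_bigr => l _; rewrite (jintZ _ a1 b1 (cJ l)) jacobi_coefE.
have Nl0 := jnorm_gt0 l a1 b1.
rewrite [RHS]mulrAC -tS//; move: (jint _ _ _) (jnorm _ _ _) Nl0 => X h h0.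
by field; rewrite gt_eqF.
Qed.

Lemma jacobi_coefZ k c f i : cont f ->
  jacobi_coef (al k) (be k) (fun x => c * f x) i =
  c * jacobi_coef (al k) (be k) f i.
Proof.
move=> cf; rewrite !jacobi_coefE mulrA; congr (_ / _).
rewrite -(jintZ _ (al_gt k) (be_gt k)).
- by apply: eq_jint => x _; rewrite mulrCA.
- by apply: within_continuousM => //; exact: within_continuous_horner.
Qed.

(** * Products of conversion matrices *)

Lemma Sprod_id N : Sprod alpha beta N N = @iid R.
Proof. by rewrite /Sprod /index_iota subnn big_nil. Qed.

Lemma SprodS N k : (k <= N)%N ->
  Sprod alpha beta N.+1 k = imul (Smat alpha beta N) (Sprod alpha beta N k).
Proof.
move=> kN; rewrite /Sprod /index_iota subSn// -addn1 iotaD rev_cat big_cons.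
by rewrite subnKC.
Qed.

Lemma Sprod_imul N k i j : (k <= N)%N ->
  Sprod alpha beta N.+1 k i j =
  \sum_(p < i.+3) Smat alpha beta N i p * Sprod alpha beta N k p j.
Proof.
move=> kN; rewrite SprodS// (@imul_finite _ _ _ _ _ i.+3)// => p ip.
by rewrite Smat_band// mul0r.
Qed.

(** Each of the [N - k] factors adds at most two superdiagonals. *)
Lemma Sprod_band N k i j : (k <= N)%N -> (i + 2 * (N - k) < j)%N ->
  Sprod alpha beta N k i j = 0.
Proof.
elim: N i j => [|N ih] i j.
  rewrite leqn0 => /eqP ->; rewrite Sprod_id addn0 /iid => ij.
  by rewrite ltn_eqF.
rewrite leq_eqVlt => /predU1P[->|]; first rewrite subnn addn0 Sprod_id => ij.
  by rewrite /iid ltn_eqF.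
rewrite ltnS => kN; rewrite subSn// mulnS addnA addn2 => ij.
rewrite Sprod_imul// big1// => p _; rewrite ih ?mulr0//.
apply: leq_ltn_trans ij; rewrite leq_add2r -ltnS; exact: ltn_ord.
Qed.

(** [jacobi_coefS] is iterated. The bound [m] is left free so that the rows [p <= i + 2] met in the
    induction share one range of summation and the sums can be exchanged. *)
Lemma jacobi_coef_Sprod N k f i m : cont f -> (k <= N)%N ->
  (i + 2 * (N - k) < m)%N ->
  jacobi_coef (al N) (be N) f i =
  \sum_(l < m) Sprod alpha beta N k i l * jacobi_coef (al k) (be k) f l.
Proof.
move=> cf.
have base k' i' : (i' < m)%N -> jacobi_coef (al k') (be k') f i' =
    \sum_(l < m) Sprod alpha beta k' k' i' l * jacobi_coef (al k') (be k') f l.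
  move=> im; rewrite Sprod_id /iid (bigD1 (Ordinal im))//= eqxx mul1r.
  rewrite big1 ?addr0// => l li; rewrite (_ : (i' == l) = false) ?mul0r//.
  apply/negbTE; rewrite eq_sym; apply: contraNneq li => li.
  exact/eqP/val_inj.
elim: N i => [|N ih] i.
  by rewrite leqn0 => /eqP ->; rewrite addn0; exact: base.
rewrite leq_eqVlt => /predU1P[->|]; first by rewrite subnn addn0; exact: base.
rewrite ltnS => kN; rewrite subSn// mulnS addnA addn2 => im.
rewrite jacobi_coefS//.
under eq_bigr => p _.
  rewrite ih//; last first.
    by apply: leq_ltn_trans im; rewrite leq_add2r -ltnS; exact: ltn_ord.
  rewrite mulr_sumr.
  over.
rewrite exchange_big; apply: eq_bigr => l _ /=.
rewrite Sprod_imul// mulr_suml.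
by apply: eq_bigr => p _; rewrite mulrA.
Qed.

Lemma imul_Dmat A k i j : imul A (Dmat alpha beta k) i j =
  if (k <= j)%N then A i (j - k)%N * Dmat alpha beta k (j - k) j else 0.
Proof.
rewrite (@imul_finite _ _ _ _ _ j.+1); last first.
  move=> l jl; rewrite Dmat_eq0 ?mulr0//.
  by rewrite ltn_eqF// (leq_trans jl)// leq_addr.
case: ifPn => [kj|]; last rewrite -ltnNge => jk.
  have jkj : (j - k < j.+1)%N by rewrite ltnS leq_subr.
  rewrite (bigD1 (Ordinal jkj))//= big1 ?addr0// => l lj.
  rewrite Dmat_eq0 ?mulr0//; apply: contraNneq lj => jE.
  by apply/eqP/val_inj/eqP; rewrite /= -(eqn_add2r k) subnK// -jE.
rewrite big1// => l _; rewrite Dmat_eq0 ?mulr0//.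
by rewrite ltn_eqF// (leq_trans jk)// leq_addl.
Qed.

Lemma imul_Sprod_Mmat N k h i j : (k <= N)%N -> cont h ->
  imul (Sprod alpha beta N k) (Mmat alpha beta k h) i j =
  jacobi_coef (al N) (be N) (fun x => h x * (J k j).[x]) i.
Proof.
move=> kN ch.
have cf : cont (fun x => h x * (J k j).[x]).
  by apply: within_continuousM => //; exact: within_continuous_horner.
rewrite (jacobi_coef_Sprod cf kN (ltnSn _)).
rewrite (@imul_finite _ _ _ _ _ (i + 2 * (N - k)).+1)//.
by move=> l il; rewrite Sprod_band// mul0r.
Qed.

(** For [k <= j] this is [derivn_jacobi]; for [k > j] the derivative of a polynomial of degree [j]
    vanishes. *)
Lemma jacobi_coef_derivn N k h i j : cont h ->
  (if (k <= j)%N then jacobi_coef (al N) (be N)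
     (fun x => h x * (J k (j - k)).[x]) i * Dmat alpha beta k (j - k) j else 0) =
  jacobi_coef (al N) (be N)
    (fun x => h x * derive1n k (horner (jacobi alpha beta j)) x) i.
Proof.
move=> ch; rewrite derive1n_horner; case: ifPn => [kj|].
  have := derivn_jacobi k (j - k); rewrite subnK// => ->.
  rewrite mulrC -jacobi_coefZ; last first.
    by apply: within_continuousM => //; exact: within_continuous_horner.
  by congr jacobi_coef; apply/funext => x; rewrite hornerZ mulrCA.
rewrite -ltnNge => jk.
have -> : (jacobi alpha beta j)^`(k) = 0.
  by apply: derivn_poly0; rewrite size_jacobi.
have c0 : cont (fun=> (0 : R)) by exact: within_continuous_cst.
rewrite -[LHS](mul0r (jacobi_coef (al N) (be N) (fun=> 0) i)).
by rewrite -jacobi_coefZ//; congr jacobi_coef; apply/funext => x;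
  rewrite hornerC !mulr0.
Qed.

(** * Coefficients of the differential operator *)

Lemma continuous_diffop N (a : nat -> R -> R) (p : {poly R}) :
  (forall k, (k <= N)%N -> cont (a k)) -> cont (diffop N a (horner p)).
Proof.
move=> ca; apply: within_continuous_sum => k.
rewrite derive1n_horner; apply: within_continuousM.
  by apply: ca; rewrite -ltnS ltn_ord.
exact: within_continuous_horner.
Qed.

Lemma diffop_sum N (a : nat -> R -> R) m (c : 'I_m -> R)
    (p : 'I_m -> {poly R}) x :
  diffop N a (horner (\sum_(l < m) c l *: p l)) x =
  \sum_(l < m) c l * diffop N a (horner (p l)) x.
Proof.
rewrite /diffop; under [RHS]eq_bigr do rewrite mulr_sumr.
rewrite exchange_big; apply: eq_bigr => k _ /=; rewrite derive1n_horner.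
rewrite linear_sum horner_sum mulr_sumr; apply: eq_bigr => l _.
by rewrite derive1n_horner linearZ hornerZ mulrCA.
Qed.

Lemma jacobi_coef_sum k n (f : 'I_n -> R -> R) i :
  (forall l : 'I_n, cont (f l)) ->
  jacobi_coef (al k) (be k) (fun x => \sum_(l < n) f l x) i =
  \sum_(l < n) jacobi_coef (al k) (be k) (f l) i.
Proof.
move=> cf; rewrite jacobi_coefE; under [RHS]eq_bigr do rewrite jacobi_coefE.
rewrite -mulr_suml; congr (_ / _).
rewrite -(jint_sum (al_gt k) (be_gt k)).
  by apply: eq_jint => x _; rewrite mulr_sumr.
by move=> l; apply: within_continuousM => //; exact: within_continuous_horner.
Qed.

(** Truncation comes after the infinite products, so the retained entries are exact. Each term of
    the operator is expanded in the basis for [k] and converted to the one for [N]. *)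
Lemma Lmat_diffop N n (a : nat -> R -> R) (i j : 'I_(n + N)) :
  (forall k, (k <= N)%N -> cont (a k)) ->
  Lmat alpha beta N n a i j =
  jacobi_coef (al N) (be N) (diffop N a (horner (jacobi alpha beta j))) i.
Proof.
move=> ca; rewrite /diffop jacobi_coef_sum; last first.
  move=> k; rewrite derive1n_horner; apply: within_continuousM.
    by apply: ca; rewrite -ltnS ltn_ord.
  exact: within_continuous_horner.
(* The term of order [N] needs no conversion and is matched apart from the others. *)
rewrite mxE big_ord_recr/= addrC; congr (_ + _).
  by rewrite imul_Dmat -jacobi_coef_derivn//; exact: ca.
apply: eq_bigr => k _; have kN : (k <= N)%N by exact: ltnW.
rewrite imul_Dmat -jacobi_coef_derivn; last exact: ca.
by case: ifP => // _; rewrite imul_Sprod_Mmat//; exact: ca.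
Qed.

(** * Factorization of the coefficient matrices *)

Lemma jint_shiftn N f :
  jint (al N) (be N) f = jint alpha beta (fun x => (1 - x ^+ 2) ^+ N * f x).
Proof.
elim: N f => [|N ih] f.
  by rewrite !addr0; apply: eq_jint => x _; rewrite expr0 mul1r.
rewrite alS beS (jint_shift _ (al_gt N) (be_gt N)) ih.
by apply: eq_jint => x _; rewrite [_ ^+ N.+1]exprSr mulrA.
Qed.

Lemma Omegamat_jnorm N n : (1 <= N)%N ->
  Omegamat alpha beta N n =
  diag_mx (\row_(j < n + N) jnorm (al N) (be N) j).
Proof.
move=> N1; rewrite /Omegamat; congr diag_mx; apply/rowP => j; rewrite !mxE.
have N1R : 1 <= N%:R :> R by rewrite ler1n.
rewrite (jnormE _ (al_gt N) (be_gt N)); last first.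
  by have a1 := alpha_gt; have b1 := beta_gt; lra.
rewrite (natrM _ 2 N).
rewrite (_ : al N + be N + 1 = alpha + beta + 2 * N%:R + 1); last by ring.
rewrite (_ : j%:R + al N + be N + 1 = j%:R + alpha + beta + 2 * N%:R + 1);
  last by ring.
rewrite (_ : j%:R + al N + 1 = j%:R + alpha + N%:R + 1); last by ring.
rewrite (_ : j%:R + be N + 1 = j%:R + beta + N%:R + 1); last by ring.
rewrite (_ : (2 * j)%:R + al N + be N + 1 =
  (2 * j)%:R + alpha + beta + 2 * N%:R + 1); last by ring.
reflexivity.
Qed.

(** The common right factor: the two Petrov-Galerkin matrices and [Omegamat *m (Lmat *m RJ)] are all
    expressed through it. *)
Definition test_matrix N n (a : nat -> R -> R) (RJ : 'M[R]_(n + N, n)) :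
    'M[R]_(n + N, n) :=
  \matrix_(l < n + N, j < n) jint (al N) (be N) (fun x => (J N l).[x] *
    diffop N a (horner (qmul (jacobi alpha beta) RJ j)) x).

(** Coefficients are inner products divided by squared norms, which the diagonal of [Omegamat]
    restores; [RJ] enters through linearity of the operator. *)
Lemma Omega_L_R_test N n (a : nat -> R -> R) (RJ : 'M[R]_(n + N, n)) :
  (1 <= N)%N -> (forall k, (k <= N)%N -> cont (a k)) ->
  Omegamat alpha beta N n *m (Lmat alpha beta N n a *m RJ) = test_matrix a RJ.
Proof.
move=> N1 ca; apply/matrixP => l j.
rewrite Omegamat_jnorm// mul_diag_mx !mxE.
have h0 := jnorm_gt0 l (al_gt N) (be_gt N).
apply: (mulfI (lt0r_neq0 (_ : 0 < (jnorm (al N) (be N) l)^-1))).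
  by rewrite invr_gt0.
rewrite mulrA mulVf ?(lt0r_neq0 h0)// mul1r [RHS]mulrC -jacobi_coefE.
have -> : diffop N a (horner (qmul (jacobi alpha beta) RJ j)) =
    fun x => \sum_(m < n + N)
      RJ m j * diffop N a (horner (jacobi alpha beta m)) x.
  by apply/funext => x; rewrite /qmul diffop_sum.
rewrite jacobi_coef_sum; last first.
  move=> m; apply: within_continuousM; first exact: within_continuous_cst.
  exact: continuous_diffop.
apply: eq_bigr => m _.
by rewrite jacobi_coefZ ?Lmat_diffop// 1?mulrC//; exact: continuous_diffop.
Qed.

Lemma invmx_Hmat N n (h : nat -> R) :
  (forall m, (N <= m < n + N)%N -> h m != 0) ->
  invmx (Hmat N n h) = diag_mx (\row_(i < n) (h (N + i)%N)^-1).
Proof.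
move=> h0; set K := diag_mx _.
have HK : Hmat N n h *m K = 1%:M.
  rewrite /Hmat /K mulmx_diag; apply/matrixP => i j; rewrite !mxE.
  by rewrite divff// h0// leq_addr addnC ltn_add2r ltn_ord.
have [uH _] := mulmx1_unit HK.
by rewrite -[invmx _]mulmx1 -HK mulmxA mulVmx// mul1mx.
Qed.

Lemma AMPG_test N n (a : nat -> R -> R) (h : nat -> R)
    (RJ : 'M[R]_(n + N, n)) :
  (forall k, (k <= N)%N -> cont (a k)) ->
  (forall m, (N <= m < n + N)%N -> h m != 0) ->
  AMPG alpha beta a h RJ =
  invmx (Hmat N n h) *m (DNmat alpha beta N n)^T *m test_matrix a RJ.
Proof.
move=> ca h0; rewrite invmx_Hmat// -mulmxA mul_diag_mx.
apply/matrixP => i j; rewrite !mxE.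
have iN : (i < n + N)%N by rewrite (leq_trans (ltn_ord i))// leq_addr.
(* Column [N + i] of the differentiation matrix has its only nonzero entry in row [i]. *)
rewrite (bigD1 (Ordinal iN))//= big1 ?addr0; last first.
  move=> l li; rewrite !mxE Dmat_eq0 ?mul0r//.
  rewrite addnC eqn_add2r eq_sym; apply: contraNneq li => li.
  by apply/eqP/val_inj.
rewrite !mxE/= mulrA jint_shiftn.
set f := diffop _ _ _.
have cf : cont f by exact: continuous_diffop.
rewrite -(jintZ _ alpha_gt beta_gt); last first.
  have -> : (fun x => (1 - x ^+ 2) ^+ N * ((J N i).[x] * f x)) =
      (fun x => ((1 - 'X^2) ^+ N * J N i).[x] * f x).
    by apply/funext => x; rewrite !hornerE ?mulrA.
  by apply: within_continuousM => //; exact: within_continuous_horner.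
apply: eq_jint => x _; rewrite derive1n_horner [in LHS](addnC N i).
rewrite derivn_jacobi hornerZ [in RHS](addnC N i) div1r.
by ring.
Qed.

Lemma AJ_test N n (a : nat -> R -> R) (QJ RJ : 'M[R]_(n + N, n)) :
  (forall k, (k <= N)%N -> cont (a k)) ->
  AJ alpha beta a QJ RJ = QJ^T *m test_matrix a RJ.
Proof.
move=> ca; apply/matrixP => i j; rewrite !mxE.
set f := diffop _ _ _.
have cf : cont f by exact: continuous_diffop.
have cJ l : cont (fun x => (J N l).[x] * f x).
  by apply: within_continuousM => //; exact: within_continuous_horner.
transitivity (jint (al N) (be N)
    (fun x => \sum_(l < n + N) QJ l i * ((J N l).[x] * f x))).
  apply: eq_jint => x _; rewrite /qmul horner_sum mulr_suml.
  by apply: eq_bigr => l _; rewrite hornerZ mulrA.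
rewrite (jint_sum (al_gt N) (be_gt N)); last first.
  by move=> l; apply: within_continuousM => //; exact: within_continuous_cst.
apply: eq_bigr => l _; rewrite (jintZ _ (al_gt N) (be_gt N) (cJ l)) !mxE.
by [].
Qed.

End JacobiMatrices.

Theorem mainTheorem5 (R : realType) (N n : nat) (alpha beta : R)
    (a : nat -> R -> R) (h : nat -> R) (RJ : 'M[R]_(n + N, n))
    (N_ge1 : (1 <= N)%N) (n_ge1 : (1 <= n)%N)
    (alpha_gt : -1 < alpha) (beta_gt : -1 < beta)
    (a_smooth : forall k, (k <= N)%N -> smooth_on (-1) 1 (a k))
    (aN_neq0 : forall x : R, x \in `[-1, 1] -> a N x != 0)
    (h_neq0 : forall m, (N <= m < n + N)%N -> h m != 0) :
  AMPG alpha beta a h RJ =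
    invmx (Hmat N n h) *m (DNmat alpha beta N n)^T *m Omegamat alpha beta N n
      *m Lmat alpha beta N n a *m RJ /\
  (forall QJ : 'M[R]_(n + N, n),
     QJ^T = invmx (Hmat N n h) *m (DNmat alpha beta N n)^T ->
     AMPG alpha beta a h RJ = AJ alpha beta a QJ RJ).
Proof.
have ca k : (k <= N)%N -> {within `[-1, 1], continuous (a k)}.
  by move=> /a_smooth; exact: smooth_on_continuous.
have E := AMPG_test alpha_gt beta_gt RJ ca h_neq0.
split; last by move=> QJ QE; rewrite E -QE AJ_test.
by rewrite E -(Omega_L_R_test alpha_gt beta_gt RJ N_ge1 ca) !mulmxA.
Qed.
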